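(* Let $S$ be an infinite subset of $\mathbb{N}$. Let $\{G_n\}_{n\in S}$ be a sequence of $(n,d(n),\lambda(n))$-graphs with $\limsup_{n\to\infty}\frac{\lambda(n)}{d(n)}<1$, and let $p=p(n)\gg\frac{1}{\sqrt{d(n)}}$. Consider the sequence of random graphs $\{G_n(p)\}_{n\in S}$. Then $$\mathbf{P}\left(\limsup_{n\to\infty}|q^*(G_n)-q^*(G_n(p))|=0\right)=1.$$
   Context: For a $d$-regular graph $G$ on $n$ vertices whose adjacency matrix has eigenvalues (with multiplicity) $\lambda_1\ge\dots\ge\lambda_n$, $\lambda(G):=\max\{\lambda_2,-\lambda_n\}$. An $(n,d,\lambda)$-graph is a $d$-regular graph $G$ on $n$ vertices with $\lambda(G)=\lambda$. For a graph $G$ and $p\in[0,1]$, $G(p)$ is the random graph obtained from $G$ by removing every edge with probability $1-p$ independently of all other edges. The random graphs of the sequence are regarded as defined on a common probability space. Modularity: for a graph $G$ with $e(G)$ edges and a partition $\mathcal{A}$ of its vertex set, $q(\mathcal{A})=\sum_{A\in\mathcal{A}}\frac{e(A)}{e(G)}-\sum_{A\in\mathcal{A}}\frac{(\sum_{v\in A}\deg(v))^2}{4e(G)^2}$, where $e(A)$ is the number of edges of $G$ with both endpoints in $A$. The modularity of $G$ is $q^*(G)=\max_{\mathcal{A}}q(\mathcal{A})$, over all partitions of the vertex set. $f(n)\gg g(n)$ means $f(n)/g(n)\to\infty$ as $n\to\infty$. Limits are along $n\in S$. *)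

(* Defs.v *)
(* MathComp / MathComp-Analysis *)
From mathcomp Require Import all_boot all_order all_algebra.
From mathcomp Require Import all_classical all_reals all_analysis.

Set Implicit Arguments.
Unset Strict Implicit.
Unset Printing Implicit Defensive.

Import Order.TTheory GRing.Theory Num.Theory.
Import numFieldNormedType.Exports.
Local Open Scope classical_set_scope.
Local Open Scope ring_scope.

(** * Finite simple graphs *)

Record sgraph (V : finType) := SGraph {
  edges : {set {set V}};
  edges_card2 : [forall e in edges, #|e| == 2%N] }.

Section Graphs.
Variable V : finType.
Implicit Types (G : sgraph V) (A : {set V}).

Definition adj G (u v : V) : bool := [set u; v]%SET \in edges G.

Definition deg G (v : V) : nat := #|[set e in edges G | v \in e]%SET|.

Definition is_regular G (d : nat) : Prop := forall v, deg G v = d.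

Definition nb_edges G : nat := #|edges G|.

Definition nb_edges_in G A : nat := #|[set e in edges G | e \subset A]%SET|.

Definition volume G A : nat := (\sum_(v in A) deg G v)%N.

End Graphs.

(** * (n, d, lambda)-graphs *)

Definition adjacency_matrix (R : realType) (n : nat) (G : sgraph 'I_n)
    : 'M[R]_n :=
  \matrix_(i, j) (adj G i j)%:R.

(* [s] lists the eigenvalues of [M] with algebraic multiplicity, in
   nonincreasing order; comparing degrees gives [size s = n]. *)
Definition spectrum (R : realType) (n : nat) (M : 'M[R]_n) (s : seq R) : Prop :=
  sorted >=%R s /\ char_poly M = \prod_(x <- s) ('X - x%:P).

(* Sequences are indexed from 0: [s`_1] is lambda_2 and [s`_n.-1] is lambda_n.
   When [n <= 1] the missing lambda_2 is read as 0. *)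
Definition ndl_graph (R : realType) (n d : nat) (lambda : R) (G : sgraph 'I_n)
    : Prop :=
  is_regular G d /\
  exists2 s : seq R, spectrum (adjacency_matrix R G) s
                   & lambda = Num.max s`_1 (- s`_n.-1).

(** * Modularity *)

Section Modularity.
Variables (R : realType) (V : finType).
Implicit Types (G : sgraph V) (P : {set {set V}}).

(* As [x / 0 = 0], the score of every partition of an edgeless graph is 0. *)
Definition modularity_score G P : R :=
  \sum_(A in P) (nb_edges_in G A)%:R / (nb_edges G)%:R
  - \sum_(A in P) (volume G A)%:R ^+ 2 / (4 * (nb_edges G)%:R ^+ 2).

Definition singleton_partition : {set {set V}} := [set [set v] | v : V]%SET.

(* The initial value of the maximum is the score of a partition, see
   [modularity_max]. *)
Definition modularity G : R :=
  \big[Num.max/modularity_score G singleton_partition]_(P : {set {set V}}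
      | finset.partition P [set: V]%SET)
    modularity_score G P.

Lemma singleton_partitionP : finset.partition singleton_partition [set: V]%SET.
Proof.
apply/and3P; split.
- apply/eqP/setP => x; rewrite inE; apply/bigcupP; exists [set x]%SET.
    exact: imset_f.
  by rewrite inE.
- apply/finset.trivIsetP => _ _ /imsetP[x _ ->] /imsetP[y _ ->] neq.
  by rewrite disjoints1 inE; apply: contra neq => /eqP ->; rewrite eqxx.
- apply/negP => /imsetP[x _] /setP /(_ x); by rewrite !inE eqxx.
Qed.

Lemma modularity_max G :
  (exists2 P, finset.partition P [set: V]%SET
            & modularity G = modularity_score G P) /\
  (forall P, finset.partition P [set: V]%SET ->
     modularity_score G P <= modularity G).
Proof.
split; last by move=> P hP; apply: le_bigmax_cond.
rewrite /modularity; elim/big_ind: _ => [|x y [P hP ->] [Q hQ ->]|P hP].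
- by exists singleton_partition => //; exact: singleton_partitionP.
- by case: (leP (modularity_score G P) (modularity_score G Q)) => _;
    [exists Q | exists P].
- by exists P.
Qed.

End Modularity.

(** * The random graph G(p) *)

Section RandomGraphs.
Variables (R : realType) (disp : measure_display) (T : measurableType disp).
Variable P : probability T R.

Definition mutually_independent (I : finType) (D : {set I}) (E : I -> set T)
    : Prop :=
  forall F : {set I}, F \subset D ->
    P (\bigcap_(i in [set` F]) E i) = (\prod_(i in F) P (E i))%E.

(* Only the law of [H] is determined by [random_subgraph]; the joint law of
   several random subgraphs on the same probability space is arbitrary. *)
Definition random_subgraph (V : finType) (G : sgraph V) (p : R)
    (H : T -> sgraph V) : Prop :=
  let removed (e : {set V}) : set T := [set t | e \notin edges (H t)] in
  [/\ forall t, edges (H t) \subset edges G,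
      forall e, e \in edges G ->
        measurable (removed e) /\ P (removed e) = (1 - p)%:E
    & mutually_independent (edges G) removed].

End RandomGraphs.

(** * Asymptotics along an infinite set of indices *)

Definition along (S : set nat) : set_system nat := within S \oo.

Definition limsup_along (R : realType) (S : set nat) (u : nat -> R) : \bar R :=
  limf_esup (fun n => (u n)%:E) (along S).

Definition much_larger_along (R : realType) (S : set nat) (f g : nat -> R)
    : Prop :=
  f n / g n @[n --> along S] --> +oo.

(* Main.v *)
(* Up to an additive error 1/k the modularity is attained by partitions into at
   most k classes: merging the classes of an optimal partition by a uniformly
   random colouring with k colours multiplies its score by 1 - 1/k on average.
   The score of a colouring with k colours is a function of the numbers of edges
   of the graph inside (k^n + 2 * 2^n) edge sets of G: the monochromatic edges of
   each colouring, and the edges meeting or contained in each vertex set. By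
   Chernoff's bound each of these numbers is, in G(p), within delta p e(G) of p
   times its value in G, except with probability
   2 exp(- delta^2 p^2 e(G) / 8) = 2 exp(- delta^2 p^2 d n / 16). Since p^2 d
   tends to infinity this beats the union bound over at most 3 k^n sets, and the
   Borel-Cantelli lemma concludes. *)
Require Import Defs.
From mathcomp Require Import all_boot all_order all_algebra.
From mathcomp Require Import all_classical all_reals all_analysis.
From mathcomp Require Import ring lra.

Set Implicit Arguments.
Unset Strict Implicit.
Unset Printing Implicit Defensive.

Import Order.TTheory GRing.Theory Num.Theory.
Import numFieldNormedType.Exports.
Local Open Scope classical_set_scope.
Local Open Scope ring_scope.

(** * Colourings and modularity *)

Section RandomRecoloring.
Variables (R : numFieldType) (C : finType) (k : nat).

(** For [a != b], translating the value of [g] at [a] by [c] in the cyclic group ['I_k.+1] permutes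
    the functions, and for each [g] exactly one [c] makes the two values agree. Averaging over [c]
    gives [1 / k.+1]. *)
Lemma sum_recoloring_eq (a b : C) :
  \sum_(g : {ffun C -> 'I_k.+1}) (g a == g b)%:R =
  #|{ffun C -> 'I_k.+1}|%:R * (if a == b then 1 else k.+1%:R^-1) :> R.
Proof.
have [<-|ab] := eqVneq a b.
  by rewrite mulr1 -sum1_card natr_sum; apply: eq_bigr => g _; rewrite eqxx.
set S := (LHS).
pose shift (c : 'I_k.+1) (g : {ffun C -> 'I_k.+1}) : {ffun C -> 'I_k.+1} :=
  [ffun x => if x == a then g x + c else g x].
have shiftK c : cancel (shift c) (shift (- c)).
  move=> g; apply/ffunP => x; rewrite !ffunE.
  by case: eqP => // _; rewrite addrK.
have S_shift c : S = \sum_(g : {ffun C -> 'I_k.+1}) (c == g b - g a)%:R.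
  rewrite /S (reindex_inj (can_inj (shiftK c))); apply: eq_bigr => g _.
  by rewrite !ffunE eqxx [b == a]eq_sym (negbTE ab) [c == _]eq_sym subr_eq addrC eq_sym.
have : \sum_(c : 'I_k.+1) S = #|{ffun C -> 'I_k.+1}|%:R.
  rewrite (eq_bigr _ (fun c _ => S_shift c)) exchange_big /= -sum1_card natr_sum.
  apply: eq_bigr => g _; rewrite (bigD1 (g b - g a)) //= eqxx big1 ?addr0 //.
  by move=> c /negbTE ->.
rewrite sumr_const card_ord => <- /=.
by rewrite -[S *+ _]mulr_natr mulfK // pnatr_eq0.
Qed.

End RandomRecoloring.

Section Colorings.
Local Open Scope set_scope.
Variables (R : realType) (V : finType).
Implicit Types (G : sgraph V) (A : {set V}) (C : finType).

Definition color_class C (f : V -> C) (c : C) : {set V} :=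
  [set v | f v == c].

Definition monochromatic C (f : V -> C) (e : {set V}) : bool :=
  [forall u in e, forall v in e, f u == f v].

Definition edges_meeting G A : {set {set V}} :=
  [set e in edges G | (e :&: A) != finset.set0].

Definition edges_inside G A : {set {set V}} :=
  [set e in edges G | e \subset A].

Definition monochromatic_edges G C (f : V -> C) : {set {set V}} :=
  [set e in edges G | monochromatic f e].

(** Empty classes contribute 0, so this is the score of the partition into nonempty classes, but
    with a fixed index type and well suited to composition with a recolouring. *)
Definition coloring_score G C (f : V -> C) : R :=
  \sum_c (nb_edges_in G (color_class f c))%:R / (nb_edges G)%:R
  - \sum_c (volume G (color_class f c))%:R ^+ 2 / (4 * (nb_edges G)%:R ^+ 2).

Lemma card_edge G (e : {set V}) : e \in edges G -> #|e| = 2%N.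
Proof. by move: (edges_card2 G) => /forall_inP h /h /eqP. Qed.

Lemma edge_neq0 G (e : {set V}) : e \in edges G -> e != finset.set0.
Proof. by move=> /card_edge e2; rewrite -card_gt0 e2. Qed.

(** An edge [e] contributes [#|e :&: A|] to the volume, namely 0, 1 or 2: one for meeting [A] and
    one more for lying inside it. Volumes thus become edge counts, which pass to a subgraph by
    intersection. *)
Lemma volumeE G A : volume G A = (#|edges_meeting G A| + #|edges_inside G A|)%N.
Proof.
have -> : volume G A = (\sum_(e in edges G) #|e :&: A|)%N.
  rewrite /volume /deg.
  under eq_bigr do rewrite -sum1_card big_mkcond.
  rewrite exchange_big /= [RHS]big_mkcond /=; apply: eq_bigr => e _.
  case: (boolP (e \in edges G)) => eG; last first.
    by rewrite big1 // => v _; rewrite inE (negbTE eG).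
  rewrite -sum1_card [LHS]big_mkcond [RHS]big_mkcond.
  apply: eq_bigr => v _; rewrite !inE eG /= andbC.
  by case: (v \in A).
rewrite /edges_meeting /edges_inside -!sum1dep_card !big_mkcondr -big_split /=.
apply: eq_bigr => e /card_edge e2.
rewrite (sameP finset.setIidPl eqP) -card_gt0.
have le2 : (#|e :&: A| <= 2)%N by rewrite -e2 subset_leq_card // subsetIl.
have -> : (e :&: A == e) = (#|e :&: A| == 2)%N.
  by rewrite -e2 eqEcard subsetIl /= eqn_leq e2 le2.
by move: le2; case: #|_| => [|[|[]]].
Qed.

Lemma nb_edges_in0 G : nb_edges_in G finset.set0 = 0%N.
Proof.
apply/eqP; rewrite cards_eq0; apply/eqP/setP => e; rewrite !inE finset.subset0.
by case: (boolP (e \in edges G)) => //= /edge_neq0 /negbTE.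
Qed.

Lemma volumeT G : volume G [set: V] = (2 * nb_edges G)%N.
Proof.
rewrite volumeE mul2n -addnn; congr addn; apply: eq_card => e; rewrite !inE.
  by rewrite finset.setIT; case: (boolP (e \in edges G)) => //= /edge_neq0 ->.
by rewrite finset.subsetT andbT.
Qed.

Lemma sum_nb_edges_in_color_class G C (f : V -> C) :
  (\sum_c nb_edges_in G (color_class f c) = #|monochromatic_edges G f|)%N.
Proof.
rewrite /nb_edges_in; under eq_bigr do rewrite -sum1_card big_mkcond.
rewrite exchange_big -sum1_card [RHS]big_mkcond /=; apply: eq_bigr => e _.
rewrite !inE; case: (boolP (e \in edges G)) => /= eG; last first.
  by rewrite big1 // => c _; rewrite inE (negbTE eG).
have /set0Pn[u ue] := edge_neq0 eG.
rewrite (bigD1 (f u)) //= big1 ?addn0; last first.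
  move=> c cu; rewrite inE eG /=; case: ifP => // /fintype.subsetP /(_ _ ue).
  by rewrite inE eq_sym (negbTE cu).
rewrite inE eG /=; congr (nat_of_bool _); apply/fintype.subsetP/forall_inP.
  move=> h x xe; apply/forall_inP => y ye.
  by have := h _ xe; have := h _ ye; rewrite !inE => /eqP -> /eqP ->.
by move=> h x xe; rewrite inE; have /forall_inP /(_ _ ue) := h _ xe.
Qed.

Lemma sum_volume_sq G C (f : V -> C) :
  \sum_c (volume G (color_class f c))%:R ^+ 2 =
  \sum_u \sum_v (deg G u)%:R * (deg G v)%:R * (f u == f v)%:R :> R.
Proof.
transitivity (\sum_c \sum_u \sum_v
   (deg G u)%:R * (deg G v)%:R * ((f u == c)%:R * (f v == c)%:R) : R).
  apply: eq_bigr => c _; rewrite /volume natr_sum expr2 mulr_suml.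
  rewrite big_mkcond; apply: eq_bigr => u _; rewrite inE.
  case: eqP => _; last by rewrite big1 // => v _; rewrite mul0r mulr0.
  rewrite mulr_sumr big_mkcond; apply: eq_bigr => v _; rewrite inE.
  by case: eqP => _; rewrite mul1r ?mulr1 ?mulr0.
rewrite exchange_big; apply: eq_bigr => u _ /=.
rewrite exchange_big; apply: eq_bigr => v _ /=.
rewrite -mulr_sumr (bigD1 (f u)) //= eqxx mul1r big1 ?addr0 1?eq_sym // => c.
by rewrite eq_sym => /negbTE ->; rewrite mul0r.
Qed.

(** In this form the colouring enters only through the conditions that two given vertices share a
    colour, so averages over recolourings follow by linearity. *)
Lemma coloring_scoreE G C (f : V -> C) :
  coloring_score G f = #|monochromatic_edges G f|%:R / (nb_edges G)%:R
    - (\sum_u \sum_v (deg G u)%:R * (deg G v)%:R * (f u == f v)%:R)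
      / (4 * (nb_edges G)%:R ^+ 2).
Proof.
rewrite /coloring_score -!mulr_suml sum_volume_sq -natr_sum.
by rewrite sum_nb_edges_in_color_class.
Qed.

Lemma coloring_score_le1 G C (f : V -> C) : coloring_score G f <= 1.
Proof.
rewrite coloring_scoreE lerBlDr -[leLHS]addr0 lerD //; last first.
  rewrite divr_ge0 ?mulr_ge0 ?exprn_ge0 //.
  by apply: sumr_ge0 => u _; apply: sumr_ge0 => v _; rewrite !mulr_ge0.
have [->|m0] := eqVneq (nb_edges G) 0%N; first by rewrite invr0 mulr0.
rewrite ler_pdivrMr ?ltr0n ?lt0n // mul1r ler_nat subset_leq_card //.
by apply/fintype.subsetP => e; rewrite inE => /andP[].
Qed.

(** The endpoints are chosen before [C] and [f], so the same pair serves for [f] and for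
    [g \o f]. *)
Lemma monochromatic_card2 (e : {set V}) : #|e| = 2%N ->
  exists u v, forall C (f : V -> C), monochromatic f e = (f u == f v).
Proof.
move=> /eqP /cards2P[u [v [_ ->]]]; exists u, v => C f.
apply/forall_inP/eqP.
  move=> /(_ u); rewrite !inE eqxx => /(_ isT) /forall_inP /(_ v).
  by rewrite !inE eqxx orbT => /(_ isT) /eqP.
move=> fuv x; rewrite !inE => xuv; apply/forall_inP => y; rewrite !inE.
by case/orP: xuv => /eqP -> /orP[] /eqP ->; rewrite ?fuv eqxx.
Qed.

(** On average an indicator [x] of agreement becomes [q + (1 - q) * x]. The constant parts cancel:
    with [m] edges, the edge term gives [q * m / m] and the degree term
    [q * (2 * m) ^+ 2 / (4 * m ^+ 2)]. If [m = 0], both sides vanish. *)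
Lemma sum_coloring_score_comp G C (f : V -> C) k :
  \sum_(g : {ffun C -> 'I_k.+1}) coloring_score G (g \o f) =
  #|{ffun C -> 'I_k.+1}|%:R * (1 - k.+1%:R^-1) * coloring_score G f.
Proof.
set N : R := #|_|%:R; set q : R := k.+1%:R^-1.
under eq_bigr do rewrite coloring_scoreE.
rewrite sumrB -!mulr_suml coloring_scoreE.
have -> : \sum_(g : {ffun C -> 'I_k.+1}) #|monochromatic_edges G (g \o f)|%:R =
   N * (q * (nb_edges G)%:R + (1 - q) * #|monochromatic_edges G f|%:R) :> R.
  transitivity (\sum_(e in edges G) N * (q + (1 - q) * (monochromatic f e)%:R)).
    under eq_bigr do rewrite -sum1_card natr_sum big_mkcond.
    rewrite exchange_big /= [RHS]big_mkcond; apply: eq_bigr => e _.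
    case: (boolP (e \in edges G)) => eG; last first.
      by rewrite big1 // => g _; rewrite inE (negbTE eG).
    have [u [v me]] := monochromatic_card2 (card_edge eG).
    rewrite me; transitivity (N * (if f u == f v then 1 else q)).
      rewrite -sum_recoloring_eq; apply: eq_bigr => g _.
      by rewrite inE eG me /=; case: (_ == _).
    by case: (_ == _) => /=; ring.
  rewrite -mulr_sumr big_split -mulr_sumr sumr_const mulr_natr; congr (_ * (_ + _ * _)).
  rewrite -sum1_card natr_sum big_mkcond [RHS]big_mkcond; apply: eq_bigr => e _.
  by rewrite inE; case: (_ \in _) => //=; case: monochromatic.
have -> : \sum_(g : {ffun C -> 'I_k.+1}) \sum_u \sum_v
     (deg G u)%:R * (deg G v)%:R * ((g \o f) u == (g \o f) v)%:R =
   N * (q * (2 * (nb_edges G)%:R) ^+ 2 + (1 - q) *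
     (\sum_u \sum_v (deg G u)%:R * (deg G v)%:R * (f u == f v)%:R)) :> R.
  have -> : 2 * (nb_edges G)%:R = \sum_u (deg G u)%:R :> R.
    by rewrite -natrM -volumeT /volume natr_sum; apply: eq_bigl => u; rewrite inE.
  rewrite expr2 mulr_suml mulrDr !mulr_sumr -big_split exchange_big.
  apply: eq_bigr => u _ /=; rewrite !mulr_sumr -big_split exchange_big.
  apply: eq_bigr => v _ /=; rewrite -mulr_sumr sum_recoloring_eq.
  by rewrite -/N -/q; case: (_ == _) => /=; ring.
have [->|m0] := eqVneq (nb_edges G) 0%N.
  by rewrite !(invr0, mulr0, expr0n) /= !(invr0, mulr0, subr0).
by field; rewrite pnatr_eq0.
Qed.

(* A uniformly random [g] identifies two given colours with probability
   [1 / k.+1], so the expected score of [g \o f] is [1 - 1 / k.+1] times that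
   of [f]. *)
Lemma coarsen_coloring G C (f : V -> C) k :
  exists g : C -> 'I_k.+1,
    coloring_score G f - k.+1%:R^-1 <= coloring_score G (g \o f).
Proof.
have [/existsP[g hg]|/existsPn H] := boolP [exists g : {ffun C -> 'I_k.+1},
  coloring_score G f - k.+1%:R^-1 <= coloring_score G (g \o f)].
  by exists g.
have N0 : (0 < #|{ffun C -> 'I_k.+1}|)%N.
  by apply/card_gt0P; exists [ffun=> ord0].
have : \sum_(g : {ffun C -> 'I_k.+1}) coloring_score G (g \o f) <
   \sum_(g : {ffun C -> 'I_k.+1}) (coloring_score G f - k.+1%:R^-1).
  apply: ltr_sum; last by move=> g _; rewrite ltNge H.
  by apply/hasP; exists [ffun=> ord0]; rewrite // mem_index_enum.
rewrite sum_coloring_score_comp sumr_const -[ltRHS]mulr_natl -mulrA.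
(* The score is at most 1, so the average [(1 - q) * score] is at least [score - q], where [q] is
   [k.+1%:R^-1]. *)
rewrite ltr_pM2l ?ltr0n // mulrBl mul1r ltrD2l ltrN2.
by rewrite ltNge ler_piMr // ?invr_ge0 // coloring_score_le1.
Qed.

(** Each vertex is coloured by its own block. The colours are all the sets of vertices, and those
    outside [P] have empty classes. *)
Lemma modularity_score_pblock G (P : {set {set V}}) :
  finset.partition P [set: V] ->
  modularity_score R G P = coloring_score G (finset.pblock P).
Proof.
move=> /and3P[/eqP covP trivP P0].
have class_in A : A \in P -> color_class (finset.pblock P) A = A.
  move=> AP; apply/setP => v; rewrite inE; apply/eqP/idP => [<-|vA].
    by rewrite finset.mem_pblock covP inE.
  exact: finset.def_pblock.
have class_notin A : A \notin P -> color_class (finset.pblock P) A = finset.set0.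
  move=> AP; apply/setP => v; rewrite !inE; apply: contraNF AP => /eqP <-.
  by rewrite finset.pblock_mem // covP inE.
rewrite /modularity_score /coloring_score; congr (_ - _);
  rewrite big_mkcond; apply: eq_bigr => A _; case: ifPn => AP.
- by rewrite class_in.
- by rewrite class_notin // nb_edges_in0 mul0r.
- by rewrite class_in.
- by rewrite class_notin // /volume big_set0 expr0n mul0r.
Qed.

Lemma coloring_score_le_modularity G C (f : V -> C) :
  coloring_score G f <= modularity R G.
Proof.
pose Q := [set color_class f c | c in [set f v | v : V]].
have fib v : v \in color_class f (f v) by rewrite inE.
have partQ : finset.partition Q [set: V].
  apply/and3P; split.
  - apply/eqP/setP => v; rewrite inE; apply/bigcupP.
    by exists (color_class f (f v)) => //; rewrite !imset_f.
  - apply/finset.trivIsetP => _ _ /imsetP[c _ ->] /imsetP[c' _ ->] neq.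
    rewrite -setI_eq0; apply/eqP/setP => v; rewrite !inE.
    by apply: contraNF neq => /andP[/eqP <- /eqP <-].
  - apply/negP => /imsetP[_ /imsetP[v _ ->]] /setP /(_ v).
    by rewrite fib inE.
apply: le_trans ((modularity_max R G).2 _ partQ).
have inj : {in [set f v | v : V] &, injective (color_class f)}.
  move=> _ _ /imsetP[u _ ->] /imsetP[v _ ->] /setP /(_ u).
  by rewrite fib inE => /esym /eqP.
have class0 c : c \notin [set f v | v : V] -> color_class f c = finset.set0.
  move=> cN; apply/setP => v; rewrite !inE; apply: contraNF cN => /eqP <-.
  exact: imset_f.
rewrite /modularity_score /coloring_score !(big_imset _ inj) /=.
rewrite le_eqVlt; apply/orP; left; apply/eqP.
congr (_ - _); rewrite [RHS]big_mkcond; apply: eq_bigr => c _;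
  case: ifPn => // /class0 ->.
  by rewrite nb_edges_in0 mul0r.
by rewrite /volume big_set0 expr0n mul0r.
Qed.

(** The number of colours no longer depends on [V], which keeps the later union bound exponential in
    [#|V|]. *)
Lemma exists_coloring_modularity G k :
  exists f : V -> 'I_k.+1, modularity R G - k.+1%:R^-1 <= coloring_score G f.
Proof.
have [[P partP ->] _] := modularity_max R G.
rewrite (modularity_score_pblock _ partP).
by have [g hg] := coarsen_coloring G (finset.pblock P) k; exists (g \o finset.pblock P).
Qed.

End Colorings.

(** * Modularity of a subgraph with balanced edge counts (deterministic) *)

Section Concentration.
Variables (R : realType) (V : finType).
Implicit Types (G H : sgraph V).
Local Open Scope set_scope.

(** The sizes of these sets determine the score in [G] of every colouring with [k.+1] colours; the
    sizes of their intersections with [edges H] do so for a subgraph [H]. *)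
Definition test_edge_sets G k : {set {set {set V}}} :=
  [set monochromatic_edges G f | f : {ffun V -> 'I_k.+1}]
  :|: ([set edges_meeting G A | A : {set V}]
       :|: [set edges_inside G A | A : {set V}]).

(** With at least two colours, each of the two families indexed by vertex sets has at most as many
    members as there are colourings. *)
Lemma card_test_edge_sets G k :
  (#|test_edge_sets G k.+1| <= 3 * k.+2 ^ #|V|)%N.
Proof.
have card_set2n : #|{: {set V}}| = (2 ^ #|V|)%N.
  by rewrite -(cardsT V) -card_powerset; apply: eq_card => A; rewrite !inE finset.subsetT.
have le2 : (2 ^ #|V| <= k.+2 ^ #|V|)%N by case: #|V| => // n; rewrite leq_exp2r.
rewrite 2!mulSn mul1n.
apply: leq_trans (leq_card_setU _ _) _; apply: leq_add.
  by apply: leq_trans (leq_imset_card _ _) _; rewrite card_ffun card_ord.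
apply: leq_trans (leq_card_setU _ _) _; apply: leq_add;
  by apply: leq_trans (leq_imset_card _ _) _; rewrite card_set2n.
Qed.

(** Over the common denominator [h * m] the numerator is [(x - p * w) * m - w * (h - p * m)], at
    most [2 * delta * p * m ^+ 2] in absolute value, while [delta <= 1/2] forces
    [h >= p * m / 2]. *)
Lemma ler_ratio_dist (p delta h m x w : R) : 0 < p -> 0 < m ->
  0 <= delta <= 1/2 -> 0 <= w <= m ->
  `|h - p * m| <= delta * p * m -> `|x - p * w| <= delta * p * m ->
  `|x / h - w / m| <= 4 * delta.
Proof.
move=> p0 m0 /andP[d0 d12] /andP[w0 wm] hh hx.
have pm0 : 0 < p * m by rewrite mulr_gt0.
have h_ge : p * m / 2 <= h.
  move: hh; rewrite ler_norml => /andP[+ _]; rewrite -mulrA => hh.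
  have : delta * (p * m) <= 1 / 2 * (p * m) by rewrite ler_wpM2r // ltW.
  lra.
have h0 : 0 < h by apply: lt_le_trans h_ge; rewrite divr_gt0.
have -> : x / h - w / m = ((x - p * w) * m - w * (h - p * m)) / (h * m).
  by field; rewrite !gt_eqF.
rewrite normrM normfV (gtr0_norm (mulr_gt0 h0 m0)) ler_pdivrMr ?mulr_gt0 //.
apply: (le_trans (ler_normB _ _)); rewrite !normrM (gtr0_norm m0) (ger0_norm w0).
have s1 : `|x - p * w| * m <= delta * p * m * m by rewrite ler_wpM2r // ltW.
have s2 : w * `|h - p * m| <= m * (delta * p * m) by apply: ler_pM.
have s3 : 4 * delta * (p * m / 2 * m) <= 4 * delta * (h * m).
  by rewrite ler_wpM2l ?mulr_ge0 // ler_wpM2r // ltW.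
lra.
Qed.

Lemma sum_volume_color_class G (C : finType) (f : V -> C) :
  (\sum_c volume G (color_class f c) = 2 * nb_edges G)%N.
Proof.
rewrite -volumeT /volume [RHS](partition_big f predT) //=.
apply: eq_bigr => c _; apply: eq_bigl => v; by rewrite !inE.
Qed.

Section Comparison.
Variables (G H : sgraph V) (k : nat) (p delta : R).
Hypotheses (HG : edges H \subset edges G) (p_gt0 : 0 < p)
  (delta_range : 0 <= delta <= 1/2) (m_gt0 : (0 < nb_edges G)%N).
Hypothesis balanced : forall W, W \in test_edge_sets G k ->
  `|#|W :&: edges H|%:R - p * #|W|%:R| <= delta * p * (nb_edges G)%:R.

Let filter_edges (Q : pred {set V}) :
  [set e in edges H | Q e] = [set e in edges G | Q e] :&: edges H.
Proof.
apply/setP => e; rewrite !inE; case: (boolP (e \in edges H)) => eH.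
  by rewrite (fintype.subsetP HG) //= andbT.
by rewrite andbF.
Qed.

Let ratio_dist (W : {set {set V}}) : W \in test_edge_sets G k ->
  `|#|W :&: edges H|%:R / (nb_edges H)%:R - #|W|%:R / (nb_edges G)%:R|
    <= 4 * delta.
Proof.
move=> Wt; apply: (@ler_ratio_dist p) => //.
- by rewrite ltr0n.
- rewrite ler0n /= ler_nat subset_leq_card //.
  by move: Wt; rewrite !inE => /orP[/imsetP[f _ ->]|/orP[] /imsetP[A _ ->]];
     apply/fintype.subsetP => e; rewrite inE => /andP[].
- have -> : nb_edges H = #|edges G :&: edges H| by rewrite (finset.setIidPr HG).
  apply: (balanced (W := edges G)).
  (* The full edge set is itself a test set, which controls the denominator [nb_edges H]. *)
  have -> : edges G = edges_meeting G [set: V].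
    apply/setP => e; rewrite !inE finset.setIT.
    by case: (boolP (e \in edges G)) => //= /edge_neq0 ->.
  by rewrite !inE imset_f ?orbT.
- exact: balanced.
Qed.

(** By [volumeE] a share is the mean of two ratios of test sets, so the error stays [4 * delta]. *)
Let volume_share_dist A :
  `|(volume H A)%:R / (2 * (nb_edges H)%:R)
    - (volume G A)%:R / (2 * (nb_edges G)%:R)| <= 4 * delta :> R.
Proof.
rewrite !volumeE.
have -> : edges_meeting H A = edges_meeting G A :&: edges H by exact: filter_edges.
have -> : edges_inside H A = edges_inside G A :&: edges H by exact: filter_edges.
have mA : edges_meeting G A \in test_edge_sets G k by rewrite !inE imset_f ?orbT.
have iA : edges_inside G A \in test_edge_sets G k by rewrite !inE imset_f ?orbT.
have := ratio_dist mA; have := ratio_dist iA.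
rewrite !natrD !invfM; set x := _ / _; set y := _ / _; set z := _ / _; set t := _ / _.
rewrite !ler_norml => /andP[? ?] /andP[? ?].
rewrite ![_ * (2^-1 * _)]mulrCA ![(_ + _) / _]mulrDl -/x -/y -/z -/t.
apply/andP; split; lra.
Qed.

(** The edge term costs [4 * delta]. In the degree term [a ^+ 2 - b ^+ 2 = (a - b) * (a + b)], and
    the shares of each graph sum to at most 1, which costs [8 * delta] whatever the number of
    colours. *)
Lemma coloring_score_dist (f : V -> 'I_k.+1) :
  `|coloring_score R G f - coloring_score R H f| <= 12 * delta.
Proof.
have [d0 _] := andP delta_range.
have mono : `|\sum_c (nb_edges_in G (color_class f c))%:R / (nb_edges G)%:R
     - \sum_c (nb_edges_in H (color_class f c))%:R / (nb_edges H)%:R| <= 4 * delta.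
  rewrite -!mulr_suml -!natr_sum !sum_nb_edges_in_color_class distrC.
  have -> : monochromatic_edges H f = monochromatic_edges G f :&: edges H.
    exact: filter_edges.
  apply: ratio_dist; rewrite !inE; apply/orP; left; apply/imsetP.
  exists (finfun f) => //; apply/setP => e; rewrite !inE; congr andb.
  by apply: eq_forallb_in => u _; apply: eq_forallb_in => v _; rewrite !ffunE.
pose share (F : sgraph V) c : R :=
  (volume F (color_class f c))%:R / (2 * (nb_edges F)%:R).
have share_ge0 F c : 0 <= share F c by rewrite divr_ge0 // mulr_ge0.
have sum_share F : \sum_c share F c <= 1.
  rewrite /share -mulr_suml -natr_sum sum_volume_color_class natrM.
  have [->|m0] := eqVneq (2 * (nb_edges F)%:R : R) 0; first by rewrite mul0r.
  by rewrite divff.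
have sq F c : (volume F (color_class f c))%:R ^+ 2 / (4 * (nb_edges F)%:R ^+ 2)
    = share F c ^+ 2 :> R.
  by rewrite /share expr_div_n exprMn; congr (_ / (_ * _)); ring.
have tax : `|\sum_c share G c ^+ 2 - \sum_c share H c ^+ 2| <= 8 * delta.
  rewrite -sumrB; apply: (le_trans (ler_norm_sum _ _ _)).
  apply: (@le_trans _ _ (\sum_c 4 * delta * (share G c + share H c))).
    apply: ler_sum => c _; rewrite subr_sqr normrM.
    rewrite (ger0_norm (addr_ge0 (share_ge0 G c) (share_ge0 H c))) ler_wpM2r ?addr_ge0 // distrC.
    exact: volume_share_dist.
  rewrite -mulr_sumr big_split /=.
  have : 4 * delta * (\sum_c share G c + \sum_c share H c) <= 4 * delta * (1 + 1).
    by rewrite ler_wpM2l ?mulr_ge0 // lerD.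
  lra.
move: mono tax; rewrite /coloring_score.
rewrite (eq_bigr _ (fun c _ => sq G c)) (eq_bigr _ (fun c _ => sq H c)).
by rewrite !ler_norml => /andP[? ?] /andP[? ?]; apply/andP; split; lra.
Qed.

(** A nearly optimal colouring of either graph is tested on the other one. *)
Lemma modularity_dist :
  `|modularity R G - modularity R H| <= 12 * delta + k.+1%:R^-1.
Proof.
have [f hf] := exists_coloring_modularity R G k.
have [g hg] := exists_coloring_modularity R H k.
have := coloring_score_dist f; have := coloring_score_dist g.
have := coloring_score_le_modularity R G g.
have := coloring_score_le_modularity R H f.
move=> h1 h2; rewrite !ler_norml => /andP[? ?] /andP[? ?].
by move: hf hg; set q := k.+1%:R^-1 => hf hg; apply/andP; split; lra.
Qed.

End Comparison.
End Concentration.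

(** * Chernoff bound for the random edge set *)

(** The binomial theorem, by expanding a product of factors [1 + x] on [W] and [1 + 0] elsewhere. *)
Lemma sum_subset_expr (R : comNzRingType) (I : finType) (W : {set I}) (x : R) :
  \sum_(J : {set I} | J \subset W) x ^+ #|J| = (1 + x) ^+ #|W|.
Proof.
transitivity (\prod_i (1 + (if i \in W then x else 0))); last first.
  rewrite -prodr_const [RHS]big_mkcond; apply: eq_bigr => i _.
  by case: ifP => _; rewrite ?addr0.
under [RHS]eq_bigr do rewrite addrC.
rewrite bigA_distr [LHS]big_mkcond /=; apply: eq_bigr => J _.
case: ifPn => [/fintype.subsetP JW|/subsetPn[i iJ iW]]; last first.
  by rewrite (bigD1 i) //= iJ (negbTE iW) mul0r.
rewrite -prodr_const big_mkcond; apply: eq_bigr => i _.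
by case: ifP => // /JW ->.
Qed.

Section Chernoff.
Variables (R : realType) (I : finType) (mu : {set I} -> R) (E : {set I}) (p : R).
Hypotheses (mu_ge0 : forall Y, 0 <= mu Y) (p01 : 0 <= p <= 1).
Hypothesis mu_avoid : forall F : {set I}, F \subset E ->
  \sum_(Y : {set I} | [disjoint F & Y]) mu Y = (1 - p) ^+ #|F|.

(** Here [mu] is the law of the surviving set [Y]. Writing [a = 1 + (a - 1)] expands the power over
    the subsets [J] of [W] disjoint from [Y]; exchanging the sums leaves only the avoidance
    probabilities [mu_avoid]. *)
Lemma removed_mgf (W : {set I}) (a : R) : W \subset E ->
  \sum_(Y : {set I}) mu Y * a ^+ #|(W :\: Y)%SET| =
  (1 + (1 - p) * (a - 1)) ^+ #|W|.
Proof.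
move=> WE; rewrite -sum_subset_expr.
transitivity (\sum_(Y : {set I}) \sum_(J : {set I} | J \subset W)
    (if [disjoint J & Y] then mu Y * (a - 1) ^+ #|J| else 0)).
  apply: eq_bigr => Y _; rewrite -[a in LHS](subrKC 1) -sum_subset_expr.
  rewrite mulr_sumr -big_mkcondr; apply: eq_bigl => J.
  by rewrite finset.subsetD.
rewrite exchange_big; apply: eq_bigr => J JW.
by rewrite -big_mkcond -mulr_suml exprMn mu_avoid // (fintype.subset_trans JW).
Qed.

(** From [expR (- s) >= 1 - s] one gets [expR s <= (1 - s)^-1], and [(1 + s + 2 * s ^+ 2) * (1 - s)
    = 1 + s ^+ 2 * (1 - 2 * s)] is at least 1. *)
Lemma expR_le_quadratic (s : R) : s <= 1/2 -> expR s <= 1 + s + 2 * s ^+ 2.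
Proof.
move=> s12; have := expR_ge1Dx (- s); rewrite expRN => h.
rewrite -[expR s]invrK; apply: (@le_trans _ _ (1 - s)^-1).
  by rewrite lef_pV2 ?posrE ?invr_gt0 ?expR_gt0 //; lra.
rewrite -[leLHS]mul1r ler_pdivrMr; last by lra.
have := sqr_ge0 s; nra.
Qed.

(** The linear term of the quadratic bound cancels against the mean. Negative [s] is allowed, so
    both tails are covered; [m] makes the bound uniform in [W]. *)
Lemma removed_centered_mgf (W : {set I}) (s m : R) : W \subset E ->
  #|W|%:R <= m -> s <= 1/2 ->
  \sum_(Y : {set I}) mu Y * expR (s * (#|(W :\: Y)%SET|%:R - (1 - p) * #|W|%:R))
  <= expR (2 * s ^+ 2 * m).
Proof.
move=> WE Wm s12; have [p0 p1] := andP p01.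
under eq_bigr do rewrite mulrBr expRD mulrA [s * _%:R]mulrC expRM_natl.
rewrite -mulr_suml removed_mgf //.
have q0 : 0 <= 1 - p by lra.
have base : 1 + (1 - p) * (expR s - 1) <= expR ((1 - p) * s + 2 * s ^+ 2).
  apply: le_trans (expR_ge1Dx _); rewrite lerD2l.
  have := expR_le_quadratic s12; have := sqr_ge0 s.
  move: (s ^+ 2) (expR s) => x y x0 yx.
  have : (1 - p) * (y - 1) <= (1 - p) * (s + 2 * x) by rewrite ler_wpM2l //; lra.
  by nra.
have base0 : 0 <= 1 + (1 - p) * (expR s - 1).
  have : 0 <= (1 - p) * expR s by rewrite mulr_ge0 // expR_ge0.
  lra.
apply: (@le_trans _ _ (expR ((1 - p) * s + 2 * s ^+ 2) ^+ #|W|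
    * expR (- (s * ((1 - p) * #|W|%:R))))).
  by rewrite ler_wpM2r ?expR_ge0 // lerXn2r // nnegrE expR_ge0.
rewrite -expRM_natl -expRD ler_expR.
have : 2 * s ^+ 2 * #|W|%:R <= 2 * s ^+ 2 * m.
  by rewrite ler_wpM2l // mulr_ge0 // sqr_ge0.
lra.
Qed.

(** Exponential Markov inequality for [Z] and [- Z], where [Z] is the centred number of removed
    elements; the centred number of survivors is [- Z]. *)
Lemma removed_tail (W : {set I}) (s t m : R) : W \subset E ->
  #|W|%:R <= m -> 0 <= s <= 1/2 ->
  \sum_(Y : {set I} | t < `|#|(W :&: Y)%SET|%:R - p * #|W|%:R|) mu Y
  <= 2 * expR (2 * s ^+ 2 * m - s * t).
Proof.
move=> WE Wm /andP[s0 s12].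
set Z := fun Y : {set I} => #|(W :\: Y)%SET|%:R - (1 - p) * #|W|%:R : R.
have ZE Y : #|(W :&: Y)%SET|%:R - p * #|W|%:R = - Z Y.
  by rewrite /Z -(cardsID Y W) natrD; ring.
apply: (@le_trans _ _ (\sum_(Y : {set I}) (mu Y * expR (s * Z Y)
    + mu Y * expR (- s * Z Y)) * expR (- (s * t)))).
  rewrite big_mkcond; apply: ler_sum => Y _; rewrite -mulrDr -mulrA.
  have e0 x : 0 <= expR x :> R by exact: expR_ge0.
  case: ifPn => [tZ|_]; last by rewrite !mulr_ge0 ?addr_ge0.
  rewrite -[leLHS]mulr1 ler_wpM2l // mulrDl -!expRD.
  rewrite ZE normrN in tZ.
  have [Z0|Z0] := leP 0 (Z Y).
    rewrite -[leLHS]addr0 lerD // -expR0 ler_expR.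
    by move: tZ; rewrite ger0_norm // => tZ; nra.
  rewrite -[leLHS]add0r lerD // -expR0 ler_expR.
  by move: tZ; rewrite ltr0_norm // => tZ; nra.
rewrite -mulr_suml big_split /= expRD mulrA ler_wpM2r ?expR_ge0 //.
rewrite mulr_natl mulr2n lerD //; first exact: removed_centered_mgf.
rewrite -[s ^+ 2]sqrrN; apply: removed_centered_mgf => //; lra.
Qed.

End Chernoff.

(** * The law of the edge set of the random subgraph *)

Section RandomSubgraph.
Variables (R : realType) (disp : measure_display) (T : measurableType disp).
Variables (P : probability T R) (V : finType) (G : sgraph V) (p : R).
Variable H : T -> sgraph V.
Hypothesis H_random : random_subgraph P G p H.

Definition edge_law (Y : {set {set V}}) : R := fine (P [set t | edges (H t) = Y]).

Lemma edge_law_ge0 Y : 0 <= edge_law Y.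
Proof. exact: fine_ge0. Qed.

(** A finite intersection over all [e]: membership of an edge of [G] is a measurable event by
    hypothesis, and any other [e] is never in [H t]. *)
Lemma measurable_edges_eq Y : measurable [set t | edges (H t) = Y].
Proof.
have [HG rm _] := H_random.
have -> : [set t | edges (H t) = Y] =
    \bigcap_(e in [set: {set V}]) [set t | (e \in edges (H t)) = (e \in Y)].
  by apply/seteqP; split => t /= h; [move=> e _; rewrite /= h | apply/setP => e; exact: h].
apply: fin_bigcap_measurable => // e _.
have [eG|eG] := boolP (e \in edges G); last first.
  have eH t : (e \in edges (H t)) = false.
    by apply: contraNF eG; exact: (fintype.subsetP (HG t)).
  case: (boolP (e \in Y)) => _.
    by rewrite (_ : [set t | _] = set0) //; apply/seteqP; split => t //=; rewrite eH.
  by rewrite (_ : [set t | _] = setT) //; apply/seteqP; split => t //=; rewrite eH.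
have [mr _] := rm _ eG.
case: (boolP (e \in Y)) => _.
  rewrite (_ : [set t | _] = ~` [set t | e \notin edges (H t)]).
    exact: measurableC.
  by apply/seteqP; split => t /=; [move=> eH; apply/negP; rewrite negbK | move/negP; rewrite negbK].
rewrite (_ : [set t | _] = [set t | e \notin edges (H t)]) //.
by apply/seteqP; split => t /=; [move/negbT | move/negbTE].
Qed.

Lemma edges_predE (Q : pred {set {set V}}) :
  [set t | Q (edges (H t))] = \bigcup_(Y in [set` enum Q]) [set t | edges (H t) = Y].
Proof.
apply/seteqP; split => t /=.
  by move=> Qt; exists (edges (H t)) => //=; rewrite mem_enum.
by move=> [Y /=]; rewrite mem_enum => QY ->.
Qed.

Lemma measurable_edges_pred (Q : pred {set {set V}}) :
  measurable [set t | Q (edges (H t))].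
Proof.
rewrite edges_predE; apply: fin_bigcup_measurable => [|Y _].
  exact: finite_seq.
exact: measurable_edges_eq.
Qed.

Lemma prob_edges_pred (Q : pred {set {set V}}) :
  P [set t | Q (edges (H t))] = (\sum_(Y | Q Y) edge_law Y)%:E.
Proof.
rewrite edges_predE measure_fin_bigcup; last first.
- by move=> Y _; exact: measurable_edges_eq.
- by move=> Y Z _ _ [t [/= <- <-]].
- exact: finite_seq.
rewrite -fsbig_seq ?enum_uniq // big_enum /= -sumEFin; apply: eq_bigr => Y _.
by rewrite fineK // fin_num_measure //; exact: measurable_edges_eq.
Qed.

(** Avoiding [F] means that all its edges are removed, so independence of the removals applies; this
    supplies the hypothesis [mu_avoid]. *)
Lemma edge_law_avoid (F : {set {set V}}) : F \subset edges G ->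
  \sum_(Y : {set {set V}} | [disjoint F & Y]) edge_law Y = (1 - p) ^+ #|F|.
Proof.
move=> FG; have [HG rm indep] := H_random; apply: EFin_inj.
rewrite -(prob_edges_pred (fun Y => [disjoint F & Y]%B)).
have -> : [set t | [disjoint F & edges (H t)]%B] =
    \bigcap_(e in [set` F]) [set t | e \notin edges (H t)].
  apply/seteqP; split => t /=.
    by move=> dF e /= eF; rewrite (disjointFr dF).
  by move=> h; rewrite disjoint_subset; apply/fintype.subsetP => e eF; apply: h.
rewrite indep //.
under eq_bigr => e eF do rewrite (rm _ (fintype.subsetP FG _ eF)).2.
by rewrite prodEFin prodr_const.
Qed.

End RandomSubgraph.

Lemma sgraph_inj (V : finType) : injective (@edges V).
Proof.
move=> [E hE] [F hF] /= EF; rewrite EF in hE *; congr SGraph.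
exact: bool_irrelevance.
Qed.

Lemma regular_nb_edges n d (G : sgraph 'I_n) :
  is_regular G d -> (2 * nb_edges G = n * d)%N.
Proof.
move=> rG; rewrite -volumeT /volume (eq_bigr (fun=> d)) => [|v _]; last exact: rG.
by rewrite sum_nat_const cardsT card_ord.
Qed.

(** * Probability that the modularity of the random subgraph deviates *)

Section Deviation.
Variables (R : realType) (disp : measure_display) (T : measurableType disp).
Variables (P : probability T R) (V : finType) (G : sgraph V) (p : R).
Variable H : T -> sgraph V.
Hypothesis H_random : random_subgraph P G p H.
Variable eps : R.

(** An arbitrary [Y] need not be the edge set of a simple graph, hence the existential. By
    [sgraph_inj] the witness [K] is unique. *)
Let deviates (Y : {set {set V}}) : bool :=
  `[< exists K : sgraph V, [/\ edges K = Y, Y \subset edges G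
       & eps < `|modularity R G - modularity R K|] >].

Let deviatesE : [set t | eps < `|modularity R G - modularity R (H t)|] =
  [set t | deviates (edges (H t))].
Proof.
have [HG _ _] := H_random.
apply/seteqP; split => t /=.
  by move=> h; apply/asboolP; exists (H t).
by move=> /asboolP[K [/sgraph_inj -> _]].
Qed.

Lemma measurable_modularity_deviation :
  measurable [set t | eps < `|modularity R G - modularity R (H t)|].
Proof. by rewrite deviatesE; exact: (measurable_edges_pred H_random). Qed.

(** By [modularity_dist], a deviation forces some test set to be unbalanced. A union bound over at
    most [3 * k.+2 ^ #|V|] sets, each with a two-sided tail, gives the factor 6. *)
Lemma prob_modularity_deviation (k : nat) (delta : R) :
  0 < p <= 1 -> (0 < nb_edges G)%N -> 0 <= delta <= 1/2 ->
  12 * delta + k.+2%:R^-1 <= eps ->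
  (P [set t | eps < `|modularity R G - modularity R (H t)|]%R <=
   (6 * k.+2%:R ^+ #|V|
     * expR (- (delta ^+ 2 * p ^+ 2 * (nb_edges G)%:R / 8)))%:E)%E.
Proof.
move=> /andP[p0 p1] m0 d01 heps; have /andP[d0 d12] := d01.
rewrite deviatesE (prob_edges_pred H_random) lee_fin.
set m : R := (nb_edges G)%:R; set e := expR _.
have e0 : 0 <= e by exact: expR_ge0.
pose bad (W Y : {set {set V}}) :=
  delta * p * m < `|#|(W :&: Y)%SET|%:R - p * #|W|%:R|.
apply: (@le_trans _ _ (\sum_(Y : {set {set V}})
    \sum_(W in test_edge_sets G k.+1 | bad W Y) edge_law P H Y)).
  rewrite big_mkcond; apply: ler_sum => Y _.
  have mu0 := edge_law_ge0 P H Y.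
  case: ifPn => [/asboolP[K [KY YG dev]]|_]; last exact: sumr_ge0.
  have [/existsP[W /andP[Wt Wb]]|/existsPn good] :=
      boolP [exists W, (W \in test_edge_sets G k.+1) && bad W Y].
    by rewrite (bigD1 W) ?Wt //= lerDl sumr_ge0.
  have := @modularity_dist R V G K k.+1 p delta; rewrite KY.
  move=> /(_ YG p0 d01 m0) /=.
  have bal W : W \in test_edge_sets G k.+1 ->
      `|#|(W :&: Y)%SET|%:R - p * #|W|%:R| <= delta * p * (nb_edges G)%:R.
    by move=> Wt; have := good W; rewrite Wt /= /bad -leNgt.
  by move=> /(_ bal) close; move: (lt_le_trans dev (le_trans close heps)); rewrite ltxx.
rewrite (exchange_big_dep (mem (test_edge_sets G k.+1))) /=; last by move=> Y W _ /andP[].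
apply: (@le_trans _ _ (\sum_(W in test_edge_sets G k.+1) 2 * e)).
  apply: ler_sum => W Wt; under eq_bigl do rewrite Wt /=.
  have WG : W \subset edges G.
    by move: Wt; rewrite !inE => /orP[/imsetP[f _ ->]|/orP[] /imsetP[A _ ->]];
     apply/fintype.subsetP => x; rewrite inE => /andP[].
  have Wm : #|W|%:R <= m by rewrite ler_nat subset_leq_card.
  (* The value [s = delta * p / 4] minimises [2 * s ^+ 2 * m - s * t] at [t = delta * p * m], with
     minimum [- (delta ^+ 2 * p ^+ 2 * m / 8)]. *)
  have s01 : 0 <= delta * p / 4 <= 1/2 by apply/andP; split; nra.
  have p01 : 0 <= p <= 1 by rewrite ltW.
  apply: (le_trans (removed_tail (edge_law_ge0 P H) p01 (edge_law_avoid H_random)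
    (delta * p * m) WG Wm s01)).
  by rewrite le_eqVlt /e; apply/orP; left; apply/eqP; congr (_ * expR _); field.
rewrite sumr_const -[leLHS]mulr_natl.
apply: (@le_trans _ _ ((3 * k.+2 ^ #|V|)%:R * (2 * e))).
  by rewrite ler_wpM2r ?mulr_ge0 // ler_nat card_test_edge_sets.
by rewrite natrM natrX; move: (_ ^+ _) => x; lra.
Qed.

End Deviation.

(** * Almost sure convergence *)

Lemma borel_cantelli_geometric (R : realType) (disp : measure_display)
    (T : measurableType disp) (P : probability T R) (D : nat -> set T) (c : R) :
  (forall n, measurable (D n)) -> 0 <= c ->
  (\forall n \near \oo, (P (D n) <= (c / 2 ^+ n)%:E)%E) ->
  P (lim_sup_set D) = 0%E.
Proof.
move=> mD c0 [N _ bnd]; apply: lim_sup_set_cvg0 => //.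
(* The factor [2 ^+ N] makes the bound trivial, hence valid, for [n < N]. *)
pose r : R := 2 * (1 + c) * 2 ^+ N.
(* This is the general term of a geometric series with sum [r], hence the factor 2 in [r]; [1 + c]
   dominates both [c] and 1. *)
have bound n : (P (D n) <= (r / (2 ^ (n + 1))%:R)%:E)%E.
  have e : r / (2 ^ (n + 1))%:R = (1 + c) * 2 ^+ N / 2 ^+ n.
    by rewrite /r natrX addn1 exprS; field; rewrite expf_neq0.
  rewrite e; have [Nn|nN] := leqP N n.
    apply: (le_trans (bnd n Nn)); rewrite lee_fin ler_wpM2r ?invr_ge0 ?exprn_ge0 //.
    have : 1 <= 2 ^+ N :> R by rewrite exprn_ege1 // ler1n.
    nra.
  apply: (le_trans (probability_le1 _ _)) => //.
  rewrite lee_fin ler_pdivlMr ?exprn_gt0 // mul1r.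
  have : 2 ^+ n <= 2 ^+ N :> R by rewrite ler_weXn2l ?ler1n // ltnW.
  have : 0 <= 2 ^+ N :> R by rewrite exprn_ge0.
  nra.
have /cvg_lim lim_r := @cvg_geometric_eseries_half R r 0.
apply: (@le_lt_trans _ _ (r / 2 ^+ 0)%:E); last exact: ltry.
rewrite -lim_r //; apply: lee_nneseries => n _ //.
exact: bound.
Qed.

Lemma exists_invS_le (R : realType) (e : R) : 0 < e -> exists j : nat, j.+1%:R^-1 <= e.
Proof.
move=> e0; exists (Num.truncn e^-1); rewrite -[leRHS]invrK lef_pV2 ?posrE ?invr_gt0 //.
exact/ltW/truncnS_gt.
Qed.

(** Countably many thresholds suffice, so the event of the theorem becomes the complement of a
    countable union. *)
Lemma limsup_along_eq0P (R : realType) (S : set nat) (u : nat -> R) :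
  infinite_set S -> (forall n, 0 <= u n) ->
  limsup_along S u = 0%E <->
  (forall j : nat, \forall n \near \oo, S n -> u n <= j.+1%:R^-1).
Proof.
move=> infS u0; split=> [lim0 j|small].
  have : (limsup_along S u < (j.+1%:R^-1)%:E)%E by rewrite lim0 lte_fin invr_gt0.
  move=> /ereal_inf_lt[_ [W + <-]] supW.
  rewrite /along /within /=; apply: filterS => n WSn Sn.
  rewrite -lee_fin; apply: le_trans (ltW supW).
  by apply: ereal_sup_ubound; exists n => //; exact: WSn.
apply/eqP; rewrite eq_le; apply/andP; split; last first.
  apply: limf_esup_ge0 => [|n]; last by rewrite lee_fin.
  (* As [S] is infinite, the filter [along S] does not contain the empty set, so the limsup of a
     nonnegative sequence cannot be [-oo]. *)
  move=> [N _ NS]; apply: infS; apply: (sub_finite_set _ (finite_II N)) => n Sn /=.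
  by rewrite ltnNge; apply/negP => Nn; exact: (NS n Nn Sn).
apply/lee_addgt0Pr => e e0; rewrite add0e.
have [j je] := exists_invS_le e0.
apply: (@le_trans _ _ (ereal_sup
    ((fun n => (u n)%:E) @` [set n | S n /\ u n <= j.+1%:R^-1]))).
  apply: ereal_inf_lbound; exists [set n | S n /\ u n <= j.+1%:R^-1] => //.
  rewrite /along /within /=; apply: filterS (small j) => n un Sn; split=> //.
  exact: un.
apply: ge_ereal_sup => _ [n [_ un] <-]; rewrite lee_fin.
exact: le_trans un je.
Qed.

Section Eventually.
Variables (R : realType) (disp : measure_display) (T : measurableType disp).
Variables (P : probability T R) (S : set nat) (d : nat -> nat) (p : nat -> R).
Variables (G : forall n : nat, sgraph 'I_n) (Gp : forall n : nat, T -> sgraph 'I_n).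
Hypothesis G_regular : forall n, S n -> is_regular (G n) (d n).
Hypothesis p01 : forall n, S n -> 0 <= p n <= 1.
Hypothesis p_large : much_larger_along S p (fun n => 1 / Num.sqrt (d n)%:R).
Hypothesis Gp_random : forall n, S n -> random_subgraph P (G n) (p n) (Gp n).

(** The event is empty for [n] outside [S], so that Borel-Cantelli applies to a sequence indexed by
    all of [nat]. *)
Definition deviation_event (eps : R) (n : nat) : set T :=
  [set t | S n /\ eps < `|modularity R (G n) - modularity R (Gp n t)|].

Let deviation_eventE eps n : S n -> deviation_event eps n =
  [set t | eps < `|modularity R (G n) - modularity R (Gp n t)|].
Proof. by move=> Sn; apply/seteqP; split => t; [case|]. Qed.

Let deviation_event0 eps n : ~ S n -> deviation_event eps n = set0.
Proof. by move=> nSn; apply/seteqP; split => t // -[]. Qed.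

Lemma measurable_deviation_event eps n : measurable (deviation_event eps n).
Proof.
have [Sn|nSn] := pselect (S n); last by rewrite deviation_event0.
by rewrite deviation_eventE //; exact: (measurable_modularity_deviation (Gp_random Sn)).
Qed.

Lemma density_large (A : R) : \forall n \near \oo, S n -> A <= p n ^+ 2 * (d n)%:R.
Proof.
have fS : Filter (along S) by exact: within_filter.
(* The lower bound 1 ensures that squaring [p n * Num.sqrt (d n)%:R] does not decrease it. *)
have : \forall n \near \oo, S n -> Num.max 1 A <= p n / (1 / Num.sqrt (d n)%:R).
  exact: (@cvgryPge _ _ _ fS _).1 p_large (Num.max 1 A).
apply: (@filterS _ \oo) => n h Sn; have := h Sn; rewrite div1r invrK ge_max => /andP[x1 xA].
have -> : p n ^+ 2 * (d n)%:R = (p n * Num.sqrt (d n)%:R) ^+ 2.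
  by rewrite exprMn sqr_sqrtr.
by apply: (le_trans xA); rewrite expr2 ler_peMr // (le_trans _ x1).
Qed.

(** Let [K] be the number of colours. Once [p n ^+ 2 * (d n)%:R] is at least [32 * K / delta ^+ 2],
    the exponent is at least [2 * K * n]. Since [expR (2 * K) >= 2 * K], the exponential is at most
    [(2 * K) ^- n], which against [K ^+ n] leaves [2 ^- n]. *)
Lemma prob_deviation_event (eps : R) : 0 < eps ->
  \forall n \near \oo, (P (deviation_event eps n) <= (6 / 2 ^+ n)%:E)%E.
Proof.
move=> eps0; have eps2 : 0 < eps / 2 by rewrite divr_gt0.
have [k' hk'] := exists_invS_le eps2.
pose k := k'.+1.
have hk : k.+1%:R^-1 <= eps / 2.
  by apply: le_trans hk'; rewrite lef_pV2 ?posrE // ler_nat.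
(* [12 * delta] takes at most one half of [eps]; the limited number of colours takes the other. *)
pose delta := Num.min (eps / 24) (1 / 2).
have delta0 : 0 < delta by rewrite lt_min !divr_gt0.
have [delta_eps delta12] : delta <= eps / 24 /\ delta <= 1 / 2.
  by split; rewrite ge_min lexx ?orbT.
pose K : R := k'.+2%:R.
have K0 : 0 < K by rewrite ltr0n.
near=> n.
have n0 : (0 < n)%N by near: n; exact: nbhs_infty_gt.
have [Sn|nSn] := pselect (S n); last first.
  by rewrite deviation_event0 // measure0 lee_fin divr_ge0 // exprn_ge0.
have dens : 32 * K / delta ^+ 2 <= p n ^+ 2 * (d n)%:R.
  by move: Sn; near: n; exact: density_large.
(* Positivity of this product yields [d n > 0] and [p n > 0], hence that [G n] has edges. *)
have pd0 : 0 < p n ^+ 2 * (d n)%:R.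
  by apply: lt_le_trans dens; rewrite divr_gt0 ?mulr_gt0 ?exprn_gt0.
have d0 : (0 < d n)%N.
  by rewrite lt0n; apply: contraTneq pd0 => ->; rewrite mulr0 ltxx.
have p_gt0 : 0 < p n <= 1.
  have /andP[p_ge0 ->] := p01 Sn; rewrite andbT lt_neqAle p_ge0 andbT.
  by apply: contraTneq pd0 => <-; rewrite expr0n mul0r ltxx.
have nd := regular_nb_edges (G_regular Sn).
have m0 : (0 < nb_edges (G n))%N.
  by rewrite -(ltn_pmul2l (isT : 0 < 2)%N) muln0 nd muln_gt0 n0.
have mE : (nb_edges (G n))%:R = n%:R * (d n)%:R / 2 :> R.
  by rewrite -natrM -nd natrM mulrAC divff ?mul1r.
rewrite deviation_eventE //.
have dr : 0 <= delta <= 1 / 2 by rewrite (ltW delta0).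
have heps : 12 * delta + k'.+2%:R^-1 <= eps.
  by move: hk; rewrite /k; move: (_^-1) => x ?; lra.
apply: (le_trans (prob_modularity_deviation (Gp_random Sn) p_gt0 m0 dr heps)).
rewrite lee_fin card_ord -mulrA ler_wpM2l // -/K.
set x := _ / 8.
have hx : n%:R * (2 * K) <= x.
  have -> : x = n%:R * (delta ^+ 2 * (p n ^+ 2 * (d n)%:R) / 16).
    by rewrite /x mE; field.
  rewrite ler_wpM2l // ler_pdivlMr //.
  move: dens; rewrite ler_pdivrMr ?exprn_gt0 // => dens; lra.
apply: (@le_trans _ _ (K ^+ n * ((2 * K) ^+ n)^-1)).
  rewrite ler_wpM2l ?exprn_ge0 ?(ltW K0) // expRN.
  rewrite lef_pV2 ?posrE ?expR_gt0 ?exprn_gt0 ?mulr_gt0 //.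
  apply: (@le_trans _ _ (expR (n%:R * (2 * K)))); last by rewrite ler_expR.
  rewrite expRM_natl lerXn2r ?nnegrE ?expR_ge0 ?mulr_ge0 ?(ltW K0) //.
  by apply: le_trans (expR_ge1Dx _); rewrite lerDr.
by rewrite exprMn invfM mulrCA divff ?mulr1 // expf_neq0 // gt_eqF.
Unshelve. all: by end_near. Qed.

End Eventually.

Theorem theorem3p6 (R : realType)
    (disp : measure_display) (T : measurableType disp) (P : probability T R)
    (S : set nat) (d : nat -> nat) (lambda p : nat -> R)
    (G : forall n : nat, sgraph 'I_n) (Gp : forall n : nat, T -> sgraph 'I_n)
    (S_infinite : infinite_set S)
    (G_ndl : forall n, S n -> ndl_graph (d n) (lambda n) (G n))
    (gap : (limsup_along S (fun n => lambda n / (d n)%:R)%R < 1%:E)%E)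
    (p01 : forall n, S n -> 0 <= p n <= 1)
    (p_large : much_larger_along S p (fun n => 1 / Num.sqrt (d n)%:R))
    (Gp_random : forall n, S n -> random_subgraph P (G n) (p n) (Gp n)) :
  P [set t | limsup_along S
               (fun n => `|modularity R (G n) - modularity R (Gp n t)|) = 0%:E]
  = 1%:E.
Proof.
have G_regular n : S n -> is_regular (G n) (d n) by move=> /G_ndl[].
pose D (j : nat) := lim_sup_set (deviation_event S G Gp (j.+1%:R^-1 : R)).
have mD j : measurable (D j).
  apply: bigcapT_measurable => n; apply: bigcup_measurable => i _.
  exact: (measurable_deviation_event Gp_random).
have D0 j : P (D j) = 0%E.
  apply: (@borel_cantelli_geometric _ _ _ _ _ 6) => //.
    by move=> n; exact: (measurable_deviation_event Gp_random).
  by apply: (prob_deviation_event G_regular p01 p_large Gp_random); rewrite invr_gt0.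
(* The limsup vanishes exactly when, for every [j], deviations above [j.+1%:R^-1] occur for only
   finitely many [n]. This also shows that the event is measurable. *)
have -> : [set t | limsup_along S
    (fun n => `|modularity R (G n) - modularity R (Gp n t)|) = 0%:E] =
    ~` (\bigcup_j D j).
  apply/seteqP; split => t /=.
    move=> /(limsup_along_eq0P S_infinite (fun n => normr_ge0 _)) small [j _ Dj].
    have [N _ Nsmall] := small j.
    by have [n Nn [Sn]] := Dj N I; rewrite ltNge (Nsmall n Nn Sn).
  move=> notD; apply/(limsup_along_eq0P S_infinite (fun n => normr_ge0 _)) => j.
  have : ~ D j t by move=> Dj; apply: notD; exists j.
  move=> /existsNP[N /not_implyP[_ notN]]; exists N => // n Nn Sn.
  by rewrite leNgt; apply/negP => dev; apply: notN; exists n.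
have mU : measurable (\bigcup_j D j) by exact: bigcupT_measurable.
rewrite probability_setC //.
have -> : P (\bigcup_j D j) = 0%E; last by rewrite sube0.
apply/negligibleP => //; apply: negligible_bigcup => j.
by apply/negligibleP; [exact: mD | exact: D0].
Qed.
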